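(* Let $W_{hh}\in\mathcal{M}_n(\mathbb{R})$ be a matrix with all entries $>0$ and let $w_{ih}\in\mathbb{R}^n$ be a vector with all components $>0$, such that $$\|W_{hh}\|_1=\max_{1\le j\le n}\sum_{i=1}^n|(W_{hh})_{(i,j)}|<1,\qquad \|W_{hh}\|_\infty=\max_{1\le i\le n}\sum_{j=1}^n|(W_{hh})_{(i,j)}|<1 .$$ Let $Y_t=Y_0+\mu\,t+\epsilon_t$, where $\mu\in\mathbb{R}$ is the trend and $\{\epsilon_t\}_{t\ge0}$ is an i.i.d. noise process with expectation zero and unit variance, and let $\{h_t\}$ be the process with values in $\mathbb{R}^n$ defined by $$h_t=W_{hh}\,h_{t-1}+Y_t\,w_{ih}.$$ 1. Without trend, i.e. if $\mu=0$: as $t$ goes to infinity, $h_t$ becomes centered around a random variable of finite variance. 2. With a trend, i.e. if $\mu\neq0$: $\{h_t\}$ diverges. More precisely, writing $h^\mu_t$ for the process with trend $\mu$ and $h^0_t$ for the process without trend, one has $h^\mu_t=h^0_t+\delta_t$, where $h^0_t$ has finite variance and $\delta_t$ diverges almost surely, with $\delta_t\to+\infty$ if $\mu>0$ and $\delta_t\to-\infty$ if $\mu<0$ as $t\to+\infty$ (componentwise).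
   Context: Here $h_t$ is the hidden state of a vanilla recurrent neural network with identity activation function, no biases and constrained weights, whose scalar input is the noisy line process $Y_t$ with trend $\mu$. In part 2, $h^\mu$ and $h^0$ are driven by the same noise, and $\delta_t=h^\mu_t-h^0_t$ satisfies $\delta_0=0$. The wording of part 1 is informal; it is meant in the following sense: if $h^*$ is the solution of $(I-W_{hh})h^*=Y_0\,w_{ih}$, then $h_t-h^*$ is the sum of a term converging almost surely to $0$ and a random vector of zero mean whose covariance matrix converges to a finite matrix as $t\to\infty$. *)

(* Defs.v *)
(* MathComp-Analysis development, over an arbitrary realType *)
From HB Require Import structures.
From mathcomp Require Import all_boot all_order all_algebra.
From mathcomp Require Import all_classical all_reals all_analysis.

Set Implicit Arguments.
Unset Strict Implicit.
Unset Printing Implicit Defensive.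

Import Order.TTheory GRing.Theory Num.Theory.
Import numFieldNormedType.Exports.

Local Open Scope classical_set_scope.
Local Open Scope ring_scope.

(* The seed 0 of the maxima is harmless: all the sums are nonnegative. *)
Definition mx_norm1 (R : realType) (n : nat) (W : 'M[R]_n) : R :=
  \big[Num.max/0]_(j < n) \sum_(i < n) `|W i j|.

Definition mx_norm_oo (R : realType) (n : nat) (W : 'M[R]_n) : R :=
  \big[Num.max/0]_(i < n) \sum_(j < n) `|W i j|.

Definition mutually_independent d (T : measurableType d) (R : realType)
    (P : probability T R) (X : nat -> {RV P >-> R}) : Prop :=
  forall (s : seq nat) (B : nat -> set R), uniq s ->
    (forall t, measurable (B t)) ->
    P (\bigcap_(t in [set` s]) (X t @^-1` B t)) =
    (\prod_(t <- s) P (X t @^-1` B t))%E.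

Definition identically_distributed d (T : measurableType d) (R : realType)
    (P : probability T R) (X : nat -> {RV P >-> R}) : Prop :=
  forall (s t : nat) (B : set R), measurable B ->
    distribution P (X s) B = distribution P (X t) B.

(* The library puts no sigma-algebra on 'cV[R]_n; measurability for the Borel
   sigma-algebra of R^n is measurability of every component. *)
Definition random_vector d (T : measurableType d) (R : realType) (n : nat)
    (V : T -> 'cV[R]_n) : Prop :=
  forall i, measurable_fun [set: T] (fun om => V om i 0).

(* For a measurable X, 'V_P[X] < +oo already forces E[X^2] < +oo: when X has no
   finite expectation, 'V_P[X] evaluates to E[X^2] = +oo. *)
Definition finite_variance d (T : measurableType d) (R : realType)
    (P : probability T R) (n : nat) (V : T -> 'cV[R]_n) : Prop :=
  forall i, ('V_P[(fun om => V om i 0%R)] < +oo)%E.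

Definition covariance_mx d (T : measurableType d) (R : realType)
    (P : probability T R) (n : nat) (V : T -> 'cV[R]_n) : 'M[\bar R]_n :=
  \matrix_(i, j) covariance P (fun om => V om i 0) (fun om => V om j 0).

Definition noisy_line d (T : measurableType d) (R : realType)
    (P : probability T R) (y0 mu : R) (eps : nat -> {RV P >-> R})
    (t : nat) (om : T) : R :=
  y0 + mu * t%:R + eps t om.

(* The recurrence runs from t = 1 on; hinit is the state at time 0. Starting
   instead from h_{-1} amounts to taking hinit = W *m h_{-1} + Y_0 *: w. *)
Fixpoint rnn d (T : measurableType d) (R : realType)
    (P : probability T R) (n : nat) (W : 'M[R]_n) (w : 'cV[R]_n)
    (y0 mu : R) (eps : nat -> {RV P >-> R}) (hinit : T -> 'cV[R]_n)
    (t : nat) (om : T) : 'cV[R]_n :=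
  if t is t'.+1 then
    W *m rnn W w y0 mu eps hinit t' om + noisy_line y0 mu eps t om *: w
  else hinit om.

(* Main.v *)
Require Import Defs.
From HB Require Import structures.
From mathcomp Require Import all_boot all_order all_algebra.
From mathcomp Require Import all_classical all_reals all_analysis.
From mathcomp Require Import measurable_realfun zify ring lra.

Set Implicit Arguments.
Unset Strict Implicit.
Unset Printing Implicit Defensive.

Import Order.TTheory GRing.Theory Num.Theory.
Import numFieldNormedType.Exports.

Local Open Scope classical_set_scope.
Local Open Scope ring_scope.

(* Since [mx_norm_oo W < 1], multiplication by [W] contracts the sup norm, so
   [1 - W] is invertible. Without trend, [h_t - hstar = W^t (h_0 - hstar) + r_t]
   with [r_t = \sum_(k < t) eps_(t-k) W^k w]: the first term tends to 0 surely,
   and as the noise is orthonormal in L2 (independence gives E[XY] = E[X] E[Y]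
   by Fubini), [cov(r_t)_ij] is a partial sum of [\sum_k (W^k w)_i (W^k w)_j],
   dominated by a geometric series. The trend adds a deterministic drift bounded
   below by [mu t w]. If [h_t] converged, [Y_t] would be bounded and |eps_t|
   would tend to infinity, which Chebyshev's inequality excludes a.s. *)

(** * Contraction of the sup norm by [W] *)

Section contraction.
Variables (R : realType) (n : nat) (W : 'M[R]_n).
Implicit Types v : 'cV[R]_n.

Lemma mx_norm_oo_ge0 : 0 <= mx_norm_oo W.
Proof. by rewrite /mx_norm_oo; elim/big_ind: _ => [//|x y x0 _|i _];
  [rewrite le_max x0 | exact: sumr_ge0]. Qed.

Lemma ler_mx_coord v i : `|v i 0| <= `|v|.
Proof.
rewrite [leRHS]/Num.norm/= mx_normrE.
exact: (le_bigmax _ (fun ij : 'I_n * 'I_1 => `|v ij.1 ij.2|) (i, 0)).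
Qed.

Lemma mulmx_norm_le v : `|W *m v| <= mx_norm_oo W * `|v|.
Proof.
rewrite [leLHS]/Num.norm/= mx_normrE; apply/bigmax_leP; split.
  by rewrite mulr_ge0// mx_norm_oo_ge0.
move=> [i j] _; rewrite ord1/= mxE (le_trans (ler_norm_sum _ _ _))//.
apply: (@le_trans _ _ (\sum_(k < n) `|W i k| * `|v|)).
  by apply: ler_sum => k _; rewrite normrM ler_wpM2l// ler_mx_coord.
rewrite -mulr_suml ler_wpM2r//.
exact: (le_bigmax _ (fun i => \sum_(j < n) `|W i j|) i).
Qed.

Lemma iter_mulmx_norm_le k v :
  `|iter k (mulmx W) v| <= mx_norm_oo W ^+ k * `|v|.
Proof.
elim: k => [|k IH]; first by rewrite expr0 mul1r.
rewrite iterS exprS -mulrA (le_trans (mulmx_norm_le _))//.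
by rewrite ler_wpM2l// mx_norm_oo_ge0.
Qed.

Hypothesis W_lt1 : mx_norm_oo W < 1.

Lemma iter_mulmx_cvg0 v : iter k (mulmx W) v @[k --> \oo] --> (0 : 'cV[R]_n).
Proof.
apply/norm_cvg0P.
apply: (@squeeze_cvgr _ _ _ _ (fun=> 0) (geometric `|v| (mx_norm_oo W))).
- by near=> k; rewrite normr_ge0/= mulrC iter_mulmx_norm_le.
- exact: cvg_cst.
- by apply: cvg_geometric; rewrite ger0_norm// mx_norm_oo_ge0.
Unshelve. all: by end_near. Qed.

(** A nonzero fixed vector would be strictly shortened by [W]. This gives the trivial kernel of
    [1%:M - W]. *)
Lemma mulmx_fixpoint_eq0 v : W *m v = v -> v = 0.
Proof.
move=> Wv; apply/normr0_eq0/eqP; rewrite -normr_le0 normr_id leNgt.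
apply/negP => v0.
have := mulmx_norm_le v; rewrite Wv leNgt => /negP; apply.
by rewrite gtr_pMl.
Qed.

Lemma unitmx_1B : 1%:M - W \in unitmx.
Proof.
(* [kermx] is the left kernel, whereas the contraction acts on columns, hence the transposition. *)
rewrite -unitmx_tr -row_free_unit -kermx_eq0; apply/eqP/row_matrixP => i.
rewrite row0; apply: trmx_inj; rewrite trmx0; apply: mulmx_fixpoint_eq0.
have : row i (kermx (1%:M - W)^T) *m (1%:M - W)^T = 0.
  by rewrite -row_mul mulmx_ker row0.
move=> /(congr1 trmx); rewrite trmx_mul trmxK trmx0 mulmxBl mul1mx.
by move/subr0_eq.
Qed.

End contraction.

(** There are finitely many entries, so their neighborhoods hold simultaneously. Entries in any
    topological space are allowed because covariances live in [\bar R]. *)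
Lemma cvg_mx_coord (T : topologicalType) (m n : nat) (f : nat -> 'M[T]_(m, n))
    (M : 'M[T]_(m, n)) :
  (forall i j, f t i j @[t --> \oo] --> M i j) -> f t @[t --> \oo] --> M.
Proof.
move=> fM A [P MP PA].
have : \forall t \near \oo, forall i j, P i j (f t i j).
  apply: filter_forall => i; apply: filter_forall => j.
  exact: fM (MP i j).
by apply: filterS => t; exact: PA.
Qed.

(** * The deterministic effect of the trend *)

Section drift.
Variables (R : realType) (n : nat) (W : 'M[R]_n) (w : 'cV[R]_n).

Fixpoint drift (mu : R) (t : nat) : 'cV[R]_n :=
  if t is t'.+1 then W *m drift mu t' + (mu * t%:R) *: w else 0.

(** The recurrence is affine: the initial state, [y0] and the noise all stay in the process without
    trend. *)
Lemma rnn_drift d (T : measurableType d) (P : probability T R) y0 mu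
    (eps : nat -> {RV P >-> R}) hinit t om :
  rnn W w y0 mu eps hinit t om = rnn W w y0 0 eps hinit t om + drift mu t.
Proof.
elim: t => [|t IH] /=; first by rewrite addr0.
rewrite IH mulmxDr [noisy_line y0 mu _ _ _](_ : _ =
  noisy_line y0 0 eps t.+1 om + mu * t.+1%:R); last first.
  by rewrite /noisy_line mul0r addr0 addrAC.
by rewrite scalerDl addrACA.
Qed.

Lemma driftN mu t : drift (- mu) t = - drift mu t.
Proof.
by elim: t => [|t IH] /=; rewrite ?oppr0// IH opprD mulmxN mulNr scaleNr.
Qed.

Hypotheses (W_ge0 : forall i j, 0 <= W i j) (w_gt0 : forall i, 0 < w i 0).

(** Only the latest input is kept; what [W] carries over from earlier inputs is nonnegative. *)
Lemma drift_ge mu t i : 0 <= mu -> mu * t%:R * w i 0 <= drift mu t i 0.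
Proof.
move=> mu0; have w0 j : 0 <= w j 0 by exact/ltW.
elim: t i => [|t IH] i /=; first by rewrite mxE mulr0 mul0r.
rewrite !mxE lerDr sumr_ge0// => j _; rewrite mulr_ge0//.
by rewrite (le_trans _ (IH j))// !mulr_ge0.
Qed.

Lemma drift_cvgy mu i : 0 < mu -> drift mu t i 0 @[t --> \oo] --> +oo.
Proof.
move=> mu0; apply/cvgryPge => A; near=> t.
apply: le_trans (drift_ge _ _ (ltW mu0)); rewrite mulrAC.
rewrite -ler_pdivrMl ?mulr_gt0//; near: t.
by move: (@cvgr_idn R) => /cvgryPge; exact.
Unshelve. all: by end_near. Qed.

Lemma drift_cvgNy mu i : mu < 0 -> drift mu t i 0 @[t --> \oo] --> -oo.
Proof.
move=> mu0; apply/cvgNry.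
rewrite (_ : (- _)%R = fun t => drift (- mu) t i 0).
  by apply: drift_cvgy; rewrite oppr_gt0.
by apply/funext => t; rewrite driftN mxE.
Qed.

End drift.

(** * Finite variance and square integrability *)

Section square_integrable.
Context d (T : measurableType d) (R : realType) (P : probability T R).
Implicit Types X Y : T -> R.

Lemma Lfun2_add X Y : X \in Lfun P 2%:E -> Y \in Lfun P 2%:E ->
  X \+ Y \in Lfun P 2%:E.
Proof. by move=> X2 Y2; rewrite rpredD ?lee1n. Qed.

Lemma variance_lty_Lfun2 X : measurable_fun [set: T] X ->
  ('V_P[X] < +oo)%E -> X \in Lfun P 2%:E.
Proof.
(* The centering constant [c] is real even if the expectation is not finite, so the variance is the
   integral of the square of [X \- cst c] in all cases. *)
move=> mX; rewrite /variance unlock; set c := fine 'E_P[X] => VX.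
have -> : X = ((X \- cst c) \+ cst c)%R by apply/funext => x /=; rewrite subrK.
have mY : measurable_fun [set: T] (X \- cst c).
  by apply: measurable_funB => //; exact: measurable_cst.
apply: Lfun2_add; last exact: Lfun_cst.
rewrite inE; apply/andP; split; rewrite inE//=.
rewrite /finite_norm unlock poweR_lty// (le_lt_trans _ VX)//.
rewrite unlock.
under eq_integral do rewrite /= powR_mulrn// real_normK ?num_real//.
by under [leRHS]eq_integral => x _ do rewrite -expr2.
Qed.

Lemma variance_Lfun2_lty X : X \in Lfun P 2%:E -> ('V_P[X] < +oo)%E.
Proof. by move=> X2; rewrite ltey_eq variance_fin_num. Qed.

Lemma Lfun2_1 X : X \in Lfun P 2%:E -> X \in Lfun P 1.
Proof. exact: (Lfun_subset12 (fin_num_measure P _ measurableT)). Qed.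

Lemma Lfun_measurable (p : \bar R) X :
  X \in Lfun P p -> measurable_fun [set: T] X.
Proof. by move=> /sub_Lfun_mfun; rewrite inE. Qed.

End square_integrable.

(** * Expectation of a product of independent variables *)

Section independence.
Context d (T : measurableType d) (R : realType) (P : probability T R).

(* The joint law of X and Y is the product of their laws, so Fubini applies. *)
Lemma expectationM_indep (X Y : {RV P >-> R}) :
  (forall A B : set R, measurable A -> measurable B ->
     P (X @^-1` A `&` Y @^-1` B) = (P (X @^-1` A) * P (Y @^-1` B))%E) ->
  (X : T -> R) \in Lfun P 2%:E -> (Y : T -> R) \in Lfun P 2%:E ->
  'E_P[X \* Y]%E = ('E_P[X] * 'E_P[Y])%E.
Proof.
move=> XY X2 Y2.
have mXY : measurable_fun [set: T] (fun om => (X om, Y om)).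
  exact: measurable_fun_pair.
pose XYm : {mfun T >-> (R * R)%type} := mfun_Sub (mem_set mXY).
have lawE A : measurable A ->
    (distribution P X \x distribution P Y)%E A = distribution P XYm A.
  (* Agreement on rectangles, which is the independence hypothesis, determines the product
     measure. *)
  apply: product_measure_unique => U V mU mV.
  by rewrite /distribution /pushforward/= -XY.
have mM : measurable_fun [set: R * R] (fun z : R * R => (z.1 * z.2)%:E).
  apply/measurable_EFinP; exact: measurable_funM.
have X1 := Lfun2_1 X2; have Y1 := Lfun2_1 Y2.
have XY1 := Lfun2_mul_Lfun1 X2 Y2.
have iM : (distribution P XYm).-integrable [set: R * R]
    (fun z : R * R => (z.1 * z.2)%:E).
  apply: integrable_pushforward => //.
  by move/Lfun1_integrable: XY1.
have iM' : (distribution P X \x distribution P Y)%E.-integrable [set: R * R]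
    (fun z : R * R => (z.1 * z.2)%:E).
  move/integrableP : iM => [mf fi]; apply/integrableP; split=> //.
  rewrite (eq_measure_integral (distribution P XYm))// => A mA _; exact: lawE.
have EXY : 'E_P[X \* Y]%E = (\int[distribution P X \x distribution P Y]_z
    (z.1 * z.2)%:E)%E.
  transitivity (\int[distribution P XYm]_z (z.1 * z.2)%:E)%E.
    rewrite integral_distribution//; last by move/Lfun1_integrable: XY1.
    by rewrite unlock.
  by apply: eq_measure_integral => A mA _; exact/esym/lawE.
rewrite EXY -integral12_prod_meas1//.
have EZ (Z : {RV P >-> R}) : (Z : T -> R) \in Lfun P 1 ->
    (\int[distribution P Z]_x x%:E = 'E_P[Z])%E.
  move=> Z1; rewrite integral_distribution//; first by rewrite unlock.
  exact/Lfun1_integrable.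
have iY : (distribution P Y).-integrable [set: R] EFin.
  by apply: integrable_pushforward => //; exact/Lfun1_integrable.
rewrite /fubini_F/=; under eq_integral.
  move=> x _; under eq_integral do rewrite EFinM.
  (* The inner integral is [x] times the mean of [Y], written as a real constant so that it can
     leave the outer integral. *)
  rewrite integralZl//= EZ// -(fineK (expectation_fin_num Y1)).
  over.
rewrite integralZr//= ?EZ// ?fineK ?expectation_fin_num//.
by apply: integrable_pushforward => //; exact/Lfun1_integrable.
Qed.
End independence.
Lemma mutually_independent_pair d (T : measurableType d) (R : realType)
    (P : probability T R) (X : nat -> {RV P >-> R}) s t (A B : set R) :
  mutually_independent X -> s != t -> measurable A -> measurable B ->
  P (X s @^-1` A `&` X t @^-1` B) = (P (X s @^-1` A) * P (X t @^-1` B))%E.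
Proof.
move=> indX st mA mB.
have := indX [:: s; t] (fun k => if k == s then A else B).
rewrite !big_cons big_nil eqxx eq_sym (negbTE st) mule1/= => <-.
- congr (P _); apply/seteqP; split=> [om [sA tB] k/=|om Xom].
    by rewrite !inE => /orP[] /eqP ->; rewrite ?eqxx// eq_sym (negbTE st).
  split; first by have := Xom s; rewrite /= !inE eqxx; exact.
  by have := Xom t; rewrite /= !inE eqxx orbT eq_sym (negbTE st); exact.
- by rewrite inE st.
- by move=> k; case: ifP.
Qed.

(** * Second moments and sample paths of the noise *)

Section white_noise.
Context d (T : measurableType d) (R : realType) (P : probability T R).
Variable X : nat -> {RV P >-> R}.
Hypotheses (X_indep : mutually_independent X)
  (X_mean : forall t, 'E_P[X t]%E = 0%E) (X_var : forall t, 'V_P[X t]%E = 1%E).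

Lemma noise_Lfun2 t : (X t : T -> R) \in Lfun P 2%:E.
Proof. by apply: variance_lty_Lfun2; rewrite ?X_var ?ltry. Qed.

(** The noise is centered: on the diagonal the second moment is the variance, and off it
    independence factors the expectation. *)
Lemma noise_orthonormal s t : 'E_P[X s \* X t]%E = (s == t)%:R%:E.
Proof.
have [->|st] := eqVneq s t.
  rewrite -(X_var t) varianceE ?noise_Lfun2// X_mean expe2 mule0 sube0.
  by congr expectation; apply/funext => om; rewrite expr2.
rewrite expectationM_indep ?X_mean ?mule0 ?noise_Lfun2// => A B mA mB.
exact: mutually_independent_pair.
Qed.

Lemma sum_Lfun2 n (F : 'I_n -> T -> R) :
  (forall k, F k \in Lfun P 2%:E) -> \sum_k F k \in Lfun P 2%:E.
Proof.
move=> F2; elim/big_ind: _ => //; first exact: Lfun_cst.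
by move=> f g; exact: Lfun2_add.
Qed.

Lemma expectation_bigsum n (F : 'I_n -> T -> R) :
  (forall k, F k \in Lfun P 1) ->
  'E_P[\sum_k F k]%E = (\sum_k 'E_P[F k])%E.
Proof.
move=> F1; have := @expectation_sum _ _ _ P [seq F k | k <- index_enum 'I_n].
rewrite !big_map; apply.
by move=> f /mapP[k _ ->].
Qed.

(** The time map [tau] is there because the network at time [t] weights the noise by lag, at times
    [t - k]. *)
Definition noise_comb n (a : 'I_n -> R) (tau : 'I_n -> nat) : T -> R :=
  \sum_k a k \o* X (tau k).

Lemma noise_comb_Lfun2 n a (tau : 'I_n -> nat) :
  noise_comb a tau \in Lfun P 2%:E.
Proof.
by apply: sum_Lfun2 => k; rewrite Lfun_scale ?ler1n// noise_Lfun2.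
Qed.

Lemma expectation_noise_comb n a (tau : 'I_n -> nat) :
  'E_P[noise_comb a tau]%E = 0%E.
Proof.
rewrite expectation_bigsum => [|k]; last first.
  by rewrite Lfun_scale// Lfun2_1// noise_Lfun2.
rewrite big1// => k _.
by rewrite expectationZl ?X_mean ?mule0// Lfun2_1// noise_Lfun2.
Qed.

(** Expanding the product gives a double sum; orthonormality and distinct times leave only its
    diagonal. *)
Lemma covariance_noise_comb n a b (tau : 'I_n -> nat) : injective tau ->
  covariance P (noise_comb a tau) (noise_comb b tau) = (\sum_k a k * b k)%:E.
Proof.
move=> tau_inj.
rewrite covarianceE ?Lfun2_mul_Lfun1 ?Lfun2_1 ?noise_comb_Lfun2//.
rewrite !expectation_noise_comb mule0 sube0.
pose F k l := (a k * b l) \o* (X (tau k) \* X (tau l)).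
have XX1 k l : X k \* X l \in Lfun P 1 by rewrite Lfun2_mul_Lfun1 ?noise_Lfun2.
have F1 k l : F k l \in Lfun P 1 by rewrite Lfun_scale.
have -> : noise_comb a tau * noise_comb b tau = \sum_k \sum_l F k l.
  rewrite /noise_comb mulr_suml; apply: eq_bigr => k _.
  rewrite mulr_sumr; apply: eq_bigr => l _; apply/funext => om /=.
  by rewrite /F/= [LHS]mulrACA.
rewrite expectation_bigsum => [|k]; last first.
  by elim/big_ind: _ => // [|f g]; [exact: Lfun_cst|exact: rpredD].
rewrite -sumEFin; apply: eq_bigr => k _.
rewrite expectation_bigsum// (bigD1 k)//= big1 => [|l lk].
  by rewrite adde0 expectationZl// noise_orthonormal eqxx mule1.
rewrite expectationZl// noise_orthonormal (inj_eq tau_inj) eq_sym.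
by rewrite (negbTE lk) mule0.
Qed.

(** Staying above [c] from time [N] on forces [c <= |X N|], an event of probability at most [c ^- 2]
    uniformly in [N]. *)
Lemma noise_not_escaping :
  {ae P, forall om, ~ forall c : R, \forall t \near \oo, c <= `|X t om|}.
Proof.
pose E c N := [set om | forall t, (N <= t)%N -> c <= `|X t om|].
have mX c t : measurable [set om | c <= `|X t om|].
  rewrite (_ : mkset _ = (Num.norm \o X t) @^-1` `[c, +oo[%classic).
    by rewrite -[_ @^-1` _]setTI; apply: measurableT_comp.
  by apply/seteqP; split=> om /=; rewrite in_itv/= andbT.
have mE c N : measurable (E c N).
  exact: (@bigcap_measurableType _ _ (fun t => [set om | c <= `|X t om|])
    [set t | (N <= t)%N]).
have mU c : measurable (\bigcup_N E c N) by exact: bigcup_measurable.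
have PU c : 0 < c -> (P (\bigcup_N E c N) <= (c ^- 2)%:E)%E.
  move=> c0.
  (* The sets [E c N] increase with [N], so continuity from below carries the uniform bound to their
     union. *)
  have EU : P (E c N) @[N --> \oo] --> P (\bigcup_N E c N).
    apply: nondecreasing_cvg_mu => // N M NM; apply/subsetPset => om EN t Mt.
    exact/EN/(leq_trans NM).
  apply: (cvge_le _ EU) => //; near=> N.
  have := chebyshev (X N) c0; rewrite X_var mule1 X_mean/=.
  under eq_set do rewrite subr0.
  apply: le_trans; apply: le_measure; rewrite ?inE//.
  by move=> om /(_ N (leqnn N)).
(* Integer thresholds suffice to detect escape and keep the intersection countable, hence
   measurable. *)
pose Z := \bigcap_k \bigcup_N E k.+1%:R N.
have mZ : measurable Z by exact: bigcapT_measurable.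
exists Z; split=> //.
  apply/eqP; rewrite eq_le measure_ge0 andbT; apply/lee_addgt0Pr => e e0.
  have [k _ /(_ k (leqnn k)) ke] := near_infty_natSinv_lt (PosNum e0).
  rewrite add0e (@le_trans _ _ (P (\bigcup_N E k.+1%:R N)))//.
    by apply: le_measure; rewrite ?inE// => om; exact.
  rewrite (le_trans (PU _ _))// lee_fin (le_trans _ (ltW ke))//.
  by rewrite lef_pV2 ?posrE ?exprn_gt0// ler_eXnr// ler1n.
move=> om /contrapT esc k _; have [N _ EN] := esc k.+1%:R.
by exists N => // t Nt; exact: EN.
Unshelve. all: by end_near. Qed.

End white_noise.

(** * Decomposition, moments and divergence of the hidden state *)

Section rnn.
Context d (T : measurableType d) (R : realType) (P : probability T R).
Variables (n : nat) (W : 'M[R]_n) (w : 'cV[R]_n) (eps : nat -> {RV P >-> R}).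
Implicit Types (y mu : R) (hinit : T -> 'cV[R]_n).

Definition noise_response : nat -> T -> 'cV[R]_n := rnn W w 0 0 eps (fun=> 0).

(** The fixed point absorbs the constant input [y0]; by superposition the rest splits into the
    decaying initial deviation and the response to the noise alone. *)
Lemma rnn_sub_fixpoint y0 hinit hstar t om :
  (1%:M - W) *m hstar = y0 *: w ->
  rnn W w y0 0 eps hinit t om - hstar =
  iter t (mulmx W) (hinit om - hstar) + noise_response t om.
Proof.
rewrite mulmxBl mul1mx => hE.
have Wh : W *m hstar = hstar - y0 *: w by rewrite -hE opprB addrCA subrr addr0.
elim: t => [|t IH]; first by rewrite /= addr0.
rewrite iterS /noise_response/= -/(noise_response t om).
have -> : iter t (mulmx W) (hinit om - hstar) =
    rnn W w y0 0 eps hinit t om - hstar - noise_response t om.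
  by rewrite IH addrK.
rewrite addrA -mulmxDr subrK mulmxBr Wh opprB.
rewrite /noisy_line !mul0r !addr0 add0r scalerDl.
by rewrite !addrA; exact: addrAC.
Qed.

(** Input enters from time 1 on, so the lags [k < t] sweep the times from [t] down to 1. *)
Lemma noise_responseE t om : noise_response t om =
  \sum_(k < t) eps (t - k)%N om *: iter k (mulmx W) w.
Proof.
elim: t => [|t IH]; first by rewrite big_ord0.
rewrite big_ord_recl subn0 /noise_response/= -/(noise_response t om) IH addrC.
rewrite /noisy_line mul0r !add0r; congr (_ + _); rewrite mulmx_sumr.
by apply: eq_bigr => k _; rewrite -scalemxAr -iterS.
Qed.

Lemma noise_response_comb t i : (fun om => noise_response t om i 0) =
  noise_comb eps (fun k : 'I_t => iter k (mulmx W) w i 0) (fun k => (t - k)%N).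
Proof.
apply/funext => om; rewrite noise_responseE summxE /noise_comb fct_sumE.
by apply: eq_bigr => k _; rewrite mxE.
Qed.

Lemma rnn_coord_Lfun2 y0 hinit t :
  (forall t, (eps t : T -> R) \in Lfun P 2%:E) ->
  (forall i, (fun om => hinit om i 0) \in Lfun P 2%:E) ->
  forall i, (fun om => rnn W w y0 0 eps hinit t om i 0) \in Lfun P 2%:E.
Proof.
move=> eps2 h2; elim: t => [|t IH] i //=.
rewrite (_ : (fun _ => _) =
    (\sum_k W i k \o* (fun om => rnn W w y0 0 eps hinit t om k 0)) \+
    w i 0 \o* (cst y0 \+ eps t.+1)).
  apply: Lfun2_add; first by apply: sum_Lfun2 => k; rewrite Lfun_scale ?ler1n.
  by rewrite Lfun_scale ?ler1n// Lfun2_add// Lfun_cst.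
apply/funext => om; rewrite !mxE /= fct_sumE /noisy_line mul0r addr0.
by congr (_ + _); apply: eq_bigr => k _; rewrite mulrC.
Qed.

(** A convergent path is bounded, hence so is the input recovered from two successive states; the
    noise must then offset the unbounded [mu * t%:R]. *)
Lemma rnn_cvg_escape y0 mu hinit i om : 0 < w i 0 -> mu != 0 ->
  cvg (rnn W w y0 mu eps hinit t om @[t --> \oo]) ->
  forall c : R, \forall t \near \oo, c <= `|eps t om|.
Proof.
move=> wi mu0 /cvg_seq_bounded[M0 [_ hM]] c; pose M := M0 + 1.
have {}hM t : `|rnn W w y0 mu eps hinit t om| <= M.
  by apply: hM => //; rewrite ltrDl.
have Y_le t : `|noisy_line y0 mu eps t.+1 om| * w i 0 <= M + mx_norm_oo W * M.
  rewrite -(gtr0_norm wi) -normrM.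
  have -> : noisy_line y0 mu eps t.+1 om * w i 0 =
      (rnn W w y0 mu eps hinit t.+1 om -
       W *m rnn W w y0 mu eps hinit t om) i 0.
    by rewrite /= addrC addKr mxE.
  rewrite (le_trans (ler_mx_coord _ _))// (le_trans (ler_normB _ _))// lerD//.
  by rewrite (le_trans (mulmx_norm_le _ _))// ler_wpM2l// mx_norm_oo_ge0.
(* Once the trend exceeds [K], removing the bounds on the input and on [y0] leaves at least [c] for
   the noise. *)
pose K := (M + mx_norm_oo W * M) / w i 0 + `|y0| + c.
near=> t.
have t0 : (0 < t)%N by near: t; exact: nbhs_infty_gt.
have Kt : K <= `|mu| * t%:R.
  rewrite mulrC -ler_pdivrMr ?normr_gt0//; near: t.
  by move: (@cvgr_idn R) => /cvgryPge; exact.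
have {}Y_le : `|noisy_line y0 mu eps t om| <= (M + mx_norm_oo W * M) / w i 0.
  by rewrite ler_pdivlMr// -(prednK t0) Y_le.
have : `|mu| * t%:R <= `|noisy_line y0 mu eps t om| + `|y0| + `|eps t om|.
  rewrite -[t%:R]normr_nat -normrM.
  have -> : mu * t%:R = noisy_line y0 mu eps t om - y0 - eps t om.
    by rewrite /noisy_line; ring.
  by rewrite (le_trans (ler_normB _ _))// lerD2r ler_normB.
rewrite /K in Kt; lra.
Unshelve. all: by end_near. Qed.

(** Each factor is at most [mx_norm_oo W ^+ k] times the norm of [w], so the ratio of the dominating
    series is the square of [mx_norm_oo W]. *)
Lemma response_covariance_cvg i j : mx_norm_oo W < 1 ->
  cvgn (series (fun k => iter k (mulmx W) w i 0 * iter k (mulmx W) w j 0)).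
Proof.
move=> W1; have q0 := mx_norm_oo_ge0 W.
apply: normed_cvg.
apply: (@series_le_cvg _ _ (geometric (`|w| ^+ 2) (mx_norm_oo W ^+ 2))).
- by move=> k; exact: normr_ge0.
- by move=> k; rewrite /= !mulr_ge0// !exprn_ge0.
- move=> k; rewrite /= normrM (_ : _ * (_ ^+ k) =
    (mx_norm_oo W ^+ k * `|w|) * (mx_norm_oo W ^+ k * `|w|)).
    apply: ler_pM => //;
      by rewrite (le_trans (ler_mx_coord _ _))// iter_mulmx_norm_le.
  by rewrite exprAC; ring.
- apply: is_cvg_geometric_series.
  by rewrite ger0_norm ?exprn_ge0// exprn_ilt1.
Qed.

End rnn.
Theorem mainTheorem4 (R : realType) (d : measure_display)
    (T : measurableType d) (P : probability T R)
    (n : nat) (n_gt0 : (0 < n)%N)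
    (W : 'M[R]_n) (w : 'cV[R]_n)
    (W_gt0 : forall i j, 0 < W i j) (w_gt0 : forall i, 0 < w i 0)
    (W_norm1 : mx_norm1 W < 1) (W_norm_oo : mx_norm_oo W < 1)
    (y0 mu : R) (eps : nat -> {RV P >-> R})
    (eps_indep : mutually_independent eps)
    (eps_ident : identically_distributed eps)
    (eps_mean : forall t, 'E_P[eps t]%E = 0%E)
    (eps_var : forall t, 'V_P[eps t]%E = 1%E)
    (hinit : T -> 'cV[R]_n) (hinit_rv : random_vector hinit) :
  (mu = 0 ->
    exists hstar : 'cV[R]_n,
      [/\ (1%:M - W) *m hstar = y0 *: w,
          (forall h' : 'cV[R]_n, (1%:M - W) *m h' = y0 *: w -> h' = hstar) &
          exists a r : nat -> T -> 'cV[R]_n,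
            [/\ (forall t om,
                   rnn W w y0 mu eps hinit t om - hstar = a t om + r t om),
                {ae P, forall om, a t om @[t --> \oo] --> (0 : 'cV[R]_n)},
                (forall t, [/\ random_vector (r t),
                               finite_variance P (r t) &
                               forall i, 'E_P[(fun om => r t om i 0%R)]%E
                                         = 0%E]) &
                exists Sigma : 'M[R]_n,
                  covariance_mx P (r t) @[t --> \oo] --> map_mx EFin Sigma]])
  /\
  (mu != 0 ->
    {ae P, forall om, ~ cvg (rnn W w y0 mu eps hinit t om @[t --> \oo])} /\
    exists delta : nat -> T -> 'cV[R]_n,
      [/\ (forall om, delta 0%N om = 0),
          (forall t om, rnn W w y0 mu eps hinit t om =
                        rnn W w y0 0 eps hinit t om + delta t om),
          (finite_variance P hinit ->
             forall t, finite_variance P (rnn W w y0 0 eps hinit t)),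
          (0 < mu ->
             {ae P, forall om, forall i, delta t om i 0 @[t --> \oo] --> +oo}) &
          (mu < 0 ->
             {ae P, forall om, forall i, delta t om i 0 @[t --> \oo] --> -oo})]).
Proof.
have eps2 := noise_Lfun2 eps_var.
split=> [->|mu0].
  have W1u := unitmx_1B W_norm_oo.
  pose hstar := invmx (1%:M - W) *m (y0 *: w).
  have hstarE : (1%:M - W) *m hstar = y0 *: w by rewrite mulKVmx.
  exists hstar; split=> // [h' h'E|]; first by rewrite /hstar -h'E mulKmx.
  pose c k := iter k (mulmx W) w.
  exists (fun t om => iter t (mulmx W) (hinit om - hstar)).
  exists (noise_response W w eps); split.
  - by move=> t om; exact: rnn_sub_fixpoint.
  - by apply/aeW => om; exact: iter_mulmx_cvg0.
  - move=> t; split=> i; rewrite noise_response_comb.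
    + exact: (Lfun_measurable (noise_comb_Lfun2 eps_var _ _)).
    + exact/variance_Lfun2_lty/noise_comb_Lfun2.
    + exact: expectation_noise_comb.
  exists (\matrix_(i, j) limn (series (fun k => c k i 0 * c k j 0))).
  apply: cvg_mx_coord => i j; rewrite !mxE.
  (* Indexed by lag, the summands do not depend on [t]: the covariances are partial sums of one
     series. *)
  rewrite (_ : (fun _ => _) = EFin \o series (fun k => c k i 0 * c k j 0)).
    by apply: cvg_EFin; [exact: nearW | exact: response_covariance_cvg].
  apply/funext => t; rewrite mxE !noise_response_comb covariance_noise_comb//.
    by rewrite /series/= big_mkord.
  (* Truncated subtraction from [t] is injective only below [t], so the ordinal bounds are put in
     context. *)
  move=> k l; have := ltn_ord k; have := ltn_ord l => ? ? kl.
  by apply: val_inj => /=; lia.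
split.
  have := noise_not_escaping eps_mean eps_var.
  apply: filterS => om + hcvg; apply.
  (* One coordinate is enough, and [n_gt0] provides it. *)
  exact: (rnn_cvg_escape (w_gt0 (Ordinal n_gt0)) mu0 hcvg).
have W_ge0 i j : 0 <= W i j by exact/ltW.
exists (fun t _ => drift W w mu t); split=> //.
- by move=> t om; exact: rnn_drift.
- move=> hvar t i; apply: variance_Lfun2_lty; apply: rnn_coord_Lfun2 => // k.
  exact: variance_lty_Lfun2.
- by move=> mu_gt0; apply/aeW => om i; exact: drift_cvgy.
- by move=> mu_lt0; apply/aeW => om i; exact: drift_cvgNy.
Qed.
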